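(* The approximation ratio of the Knapsack-Batching algorithm for MWSBP satisfies $\mathcal{R}(\mathtt{KB})\le \frac{17}{10}$; that is, for every instance, every output of $\mathtt{KB}$ has cost at most $\frac{17}{10}\cdot\mathtt{OPT}$.
   Context: Min-Weighted Sum Bin Packing (MWSBP): an instance consists of $n$ items with sizes $s_i\in(0,1]$ and weights $w_i>0$. A feasible solution is a partition of the items into bins $B_1,\ldots,B_p$ with $\sum_{i\in B_k}s_i\le 1$; its cost is $\sum_{k=1}^p k\sum_{i\in B_k}w_i$; $\mathtt{OPT}$ is the minimum cost. The Knapsack-Batching algorithm ($\mathtt{KB}$): for $k=1,2,\ldots$ while items remain, let $B_k$ be a subset of the remaining items of maximum total weight subject to total size at most $1$ (ties broken arbitrarily). The approximation ratio $\mathcal{R}(\mathtt{ALG})$ of an algorithm is the smallest $\rho\ge1$ such that on every instance (and for every way the algorithm may break ties) the cost of its output is at most $\rho\cdot\mathtt{OPT}$. *)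

(* Defs.v *)
From mathcomp Require Import all_boot all_order all_algebra.
Set Implicit Arguments. Unset Strict Implicit. Unset Printing Implicit Defensive.
Import Order.TTheory GRing.Theory Num.Theory.
Local Open Scope ring_scope.

Definition mwsbp_instance (R : realFieldType) (n : nat) (s w : 'I_n -> R) : Prop :=
  forall i, 0 < s i <= 1 /\ 0 < w i.

Definition tsize (R : realFieldType) (n : nat) (s : 'I_n -> R) (B : {set 'I_n}) : R :=
  \sum_(i in B) s i.
Definition tweight (R : realFieldType) (n : nat) (w : 'I_n -> R) (B : {set 'I_n}) : R :=
  \sum_(i in B) w i.

(* A feasible solution: a sequence of bins B_1, ..., B_p (bin B_k is the
   (k-1)-th entry of the list) partitioning the items, each of total size <= 1. *)
Definition feasible_solution (R : realFieldType) (n : nat) (s : 'I_n -> R)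
    (Bs : seq {set 'I_n}) : Prop :=
  (forall i : 'I_n, exists2 B, B \in Bs & i \in B) /\
  (forall k1 k2, (k1 < size Bs)%N -> (k2 < size Bs)%N -> k1 <> k2 ->
     [disjoint nth set0 Bs k1 & nth set0 Bs k2]) /\
  (forall k, (k < size Bs)%N -> tsize s (nth set0 Bs k) <= 1).

Definition cost (R : realFieldType) (n : nat) (w : 'I_n -> R)
    (Bs : seq {set 'I_n}) : R :=
  \sum_(k < size Bs) (k.+1)%:R * tweight w (nth set0 Bs k).

Definition remaining (n : nat) (Bs : seq {set 'I_n}) (k : nat) : {set 'I_n} :=
  ~: (\bigcup_(j < k) nth set0 Bs j).

(* Bs is a possible output of Knapsack-Batching (for some tie-breaking):
   at each step items remain, B_k is a subset of the remaining items of
   total size <= 1 with maximum total weight among all such subsets;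
   and after the last step no item remains. *)
Definition KB_output (R : realFieldType) (n : nat) (s w : 'I_n -> R)
    (Bs : seq {set 'I_n}) : Prop :=
  (forall k, (k < size Bs)%N ->
     [/\ remaining Bs k != set0,
         nth set0 Bs k \subset remaining Bs k,
         tsize s (nth set0 Bs k) <= 1 &
         forall S : {set 'I_n}, S \subset remaining Bs k -> tsize s S <= 1 ->
           tweight w S <= tweight w (nth set0 Bs k)]) /\
  remaining Bs (size Bs) = set0.

(* Main.v *)
(* Let F be the set of items in the first p bins of a solution. Repack F
   greedily: the k-th new bin receives the still unpacked items of the k-th KB bin
   B_k and is then filled up to a maximal feasible set of unpacked items of F.
   This is a First-Fit packing of F, and its k-th bin avoids B_1, ..., B_(k-1), so
   by the choice of B_k it weighs at most w(B_k). The First-Fit weight function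
   (6/5 of the size plus a bonus) is at most 17/10 on every feasible bin and
   exceeds m - 4/5 in total on m >= 2 First-Fit bins, so there are at most
   f(p) = floor((17 p + 7) / 10) of them. Hence the first f(p) KB bins weigh at
   least as much as the first p bins of the solution.
   The cost is the sum over k >= 0 of the weight r(k) remaining after k bins, so
   the cost of the solution is at least the sum over p of r(f(p)) for the KB
   profile r. As KB bins have nonincreasing weights, r is convex, and
   10 sum_k r(k) <= 17 sum_p r(f(p)) follows by blocks of 17 values of k. *)
Require Import Defs.
From mathcomp Require Import all_boot all_order all_algebra.
From mathcomp Require Import zify ring lra.
Import Defs.
Set Implicit Arguments. Unset Strict Implicit. Unset Printing Implicit Defensive.
Import Order.TTheory GRing.Theory Num.Theory.
Local Open Scope ring_scope.

(** * The First-Fit weight function *)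

Section Bonus.
Variable R : realFieldType.
Implicit Type a : R.

(** The First-Fit weights with the bonus kept apart from the size. The value 2/5 makes every item
    above 1/2 weigh more than 1. *)
Definition bonus a : R :=
  if a <= 1 / 6 then 0 else if a <= 1 / 3 then 3 / 5 * (a - 1 / 6)
  else if a <= 1 / 2 then 1 / 10 else 2 / 5.

Definition ffweight a : R := 6 / 5 * a + bonus a.

Lemma bonus_ge0 a : 0 <= bonus a.
Proof. by rewrite /bonus; do !case: ifP => ?; lra. Qed.

Lemma bonus_small a : a <= 1 / 6 -> bonus a = 0.
Proof. by rewrite /bonus => ->. Qed.

Lemma bonus_large a : 1 / 2 < a -> bonus a = 2 / 5.
Proof. by rewrite /bonus => ?; do !case: ifP => ?; lra. Qed.

Lemma bonus_le a : a <= 1 / 2 -> bonus a <= 1 / 10.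
Proof. by rewrite /bonus => ?; do !case: ifP => ?; lra. Qed.

Lemma bonus_le_linear a : 0 <= a -> a <= 1 / 2 -> bonus a <= 3 / 5 * a.
Proof. by rewrite /bonus => ? ?; do !case: ifP => ?; lra. Qed.

Lemma bonus_le_affine a : 1 / 6 < a -> a <= 1 / 2 -> bonus a <= 3 / 5 * (a - 1 / 6).
Proof. by rewrite /bonus => ? ?; do !case: ifP => ?; lra. Qed.

Lemma bonus_ge_affine (x : R) a :
  x <= 1 / 6 -> 1 / 6 + x < a -> 3 / 5 * x <= bonus a.
Proof. by rewrite /bonus => ? ?; do !case: ifP => ?; lra. Qed.

Lemma bonus_ge_third a : 1 / 3 < a -> 1 / 10 <= bonus a.
Proof. by rewrite /bonus => ?; do !case: ifP => ?; lra. Qed.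

End Bonus.

(** * Weight bounds for feasible bins and First-Fit packings *)

Section FirstFit.
Variables (R : realFieldType) (n : nat) (s : 'I_n -> R).
Hypothesis s_bounds : forall i, 0 < s i <= 1.
Implicit Types (A B C D E F : {set 'I_n}) (i j : 'I_n).

Let s_gt0 i : 0 < s i. Proof. by case/andP: (s_bounds i). Qed.
Let s_ge0 i : 0 <= s i. Proof. exact: ltW. Qed.

Lemma tweight_ge0 (u : 'I_n -> R) A : (forall i, 0 <= u i) -> 0 <= tweight u A.
Proof. by move=> u0; apply: sumr_ge0. Qed.

Lemma tweight_set0 (u : 'I_n -> R) : tweight u set0 = 0.
Proof. by rewrite /tweight big_set0. Qed.

Lemma tweightD1 (u : 'I_n -> R) A i :
  i \in A -> tweight u A = u i + tweight u (A :\ i).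
Proof. exact: big_setD1. Qed.

Lemma tweightD (u : 'I_n -> R) A B :
  B \subset A -> tweight u A = tweight u B + tweight u (A :\: B).
Proof. by move=> BA; rewrite /tweight (big_setID B) /= (setIidPr BA). Qed.

Lemma tweight_le (u : 'I_n -> R) A B :
  (forall i, 0 <= u i) -> B \subset A -> tweight u B <= tweight u A.
Proof. by move=> u0 /(tweightD u) ->; rewrite lerDl tweight_ge0. Qed.

Definition binweight A : R := tweight (fun i => ffweight (s i)) A.
Definition binbonus A : R := tweight (fun i => bonus (s i)) A.

Lemma binweightE A : binweight A = 6 / 5 * tsize s A + binbonus A.
Proof. by rewrite /binweight /tweight big_split /= -mulr_sumr. Qed.

Lemma binbonus_ge0 A : 0 <= binbonus A.
Proof. by apply: tweight_ge0 => i; exact: bonus_ge0. Qed.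

Lemma tsize_ge0 A : 0 <= tsize s A.
Proof. exact: (@tweight_ge0 s). Qed.

(** With at most one item above 1/6 the first bound holds. Otherwise two such items each save 1/10
    against the linear bound [3/5 * s i], hence the term 1/3. *)
Lemma binbonus_no_large A : (forall i, i \in A -> s i <= 1 / 2) ->
  binbonus A <= 1 / 10 \/ binbonus A <= 3 / 5 * (tsize s A - 1 / 3).
Proof.
move=> Ale; have no_bonus D : ~~ [exists i in D, 1 / 6 < s i] -> binbonus D = 0.
  rewrite negb_exists_in => /forall_inP Dle; apply: big1 => i iD.
  by apply: bonus_small; rewrite leNgt Dle.
have [/exists_inP[i iA si]|/no_bonus ->] := boolP [exists i in A, 1 / 6 < s i];
  last by left; lra.
have [/exists_inP[j jA sj]|/no_bonus A0] :=
  boolP [exists j in A :\ i, 1 / 6 < s j]; last first.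
  by left; rewrite /binbonus (tweightD1 _ iA) [tweight _ _]A0 addr0 bonus_le ?Ale.
right; rewrite /binbonus (tweightD1 _ iA) (tweightD1 _ jA).
rewrite (_ : tsize s A = s i + (s j + tweight s (A :\ i :\ j))); last first.
  by rewrite -!tweightD1.
have := bonus_le_affine si (Ale _ iA).
have /(bonus_le_affine sj) : s j <= 1 / 2 by apply: Ale; case/setD1P: jA.
suff : tweight (fun i => bonus (s i)) (A :\ i :\ j)
       <= 3 / 5 * tweight s (A :\ i :\ j) by lra.
rewrite /tweight mulr_sumr; apply: ler_sum => k.
by rewrite !inE => /and3P[_ _ kA]; apply: bonus_le_linear; rewrite ?Ale.
Qed.

(** The extremal case has an item above 1/2: its bonus is 2/5, and the rest, of size below 1/2, has
    bonus at most 1/10 in either case of [binbonus_no_large]. *)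
Lemma binweight_le A : tsize s A <= 1 -> binweight A <= 17 / 10.
Proof.
move=> A1; rewrite binweightE.
have [/exists_inP[i iA si]|] := boolP [exists i in A, 1 / 2 < s i]; last first.
  rewrite negb_exists_in => /forall_inP Ale.
  suff /binbonus_no_large [] : forall i, i \in A -> s i <= 1 / 2 by lra.
  by move=> i iA; rewrite leNgt Ale.
have sA : tsize s A = s i + tsize s (A :\ i) by exact: tweightD1.
have bA : binbonus A = 2 / 5 + binbonus (A :\ i).
  by rewrite /binbonus (tweightD1 _ iA) bonus_large.
suff /binbonus_no_large [] : forall j, j \in A :\ i -> s j <= 1 / 2 by lra.
move=> j jA; have : tsize s (A :\ i) = s j + tsize s (A :\ i :\ j).
  exact: tweightD1.
by have := tsize_ge0 (A :\ i :\ j); lra.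
Qed.

(** The relation of a First-Fit bin [A] to any later bin [B]. *)
Definition nofit A B := [forall i in B, 1 < tsize s A + s i].

Lemma tsize_ge_item A i : i \in A -> s i <= tsize s A.
Proof.
by move=> iA; rewrite /tsize (bigD1 i) //= lerDl; apply: sumr_ge0.
Qed.

Lemma nofit_size A B : B != set0 -> nofit A B -> 1 < tsize s A + tsize s B.
Proof.
by case/set0Pn => i iB /forall_inP/(_ _ iB); have := tsize_ge_item iB; lra.
Qed.

Lemma binweight_large A i : i \in A -> 1 / 2 < s i -> 1 <= binweight A.
Proof.
move=> iA si; rewrite binweightE /binbonus (tweightD1 _ iA) bonus_large //.
have := binbonus_ge0 (A :\ i); rewrite /binbonus.
by have := tsize_ge_item iA; lra.
Qed.

Lemma tweight_ge2 (u : 'I_n -> R) A i j : (forall k, 0 <= u k) ->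
  i \in A -> j \in A -> i != j -> u i + u j <= tweight u A.
Proof.
move=> u0 iA jA ij; have jAi : j \in A :\ i by rewrite !inE eq_sym ij.
by rewrite (tweightD1 _ iA) (tweightD1 _ jAi) lerD2l lerDl tweight_ge0.
Qed.

(* If [tsize s A = 5/6 - x], then each item of [B] exceeds [1/6 + x], so that
   two of them carry the bonus [6/5 x] that [A] is missing. *)
Lemma nofit_chain A B C : nofit A B -> nofit B C -> B != set0 -> C != set0 ->
  binweight A < 1 -> binweight B < 1 -> binweight C < 1 ->
  1 <= 6 / 5 * tsize s A + binbonus B.
Proof.
move=> /forall_inP AB /forall_inP BC /set0Pn[i iB] /set0Pn[k kC] WA WB WC.
(* If [B] were a singleton, its item or an item of [C] would exceed 1/2, making [B] or [C] weigh at
   least 1. *)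
have [j jB ij] : exists2 j, j \in B & i != j.
  have [/exists_inP[j jB ij]|] := boolP [exists j in B, i != j]; first by exists j.
  rewrite negb_exists_in => /forall_inP iBE.
  have sB : tsize s B = s i.
    rewrite /tsize (bigD1 i) //= big1 ?addr0 // => j /andP[jB].
    by have := iBE _ jB; rewrite negbK eq_sym => ->.
  have := BC _ kC; rewrite sB => ik.
  have [si|si] := ltP (1 / 2) (s i); first by have := binweight_large iB si; lra.
  have : 1 / 2 < s k by lra.
  by move/(binweight_large kC); lra.
have bB : bonus (s i) + bonus (s j) <= binbonus B.
  by apply: (@tweight_ge2 (fun i => bonus (s i))) => // l; exact: bonus_ge0.
have sB : s i + s j <= tsize s B by exact: tweight_ge2.
have := AB _ iB; have := AB _ jB => Aj Ai.
move: WA WB; rewrite !binweightE => WA WB; have := binbonus_ge0 A => bA.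
(* Below 2/3 both items exceed 1/3, so [B] would weigh more than 4/5 + 1/5 = 1. *)
have [A23|A23] := ltP (tsize s A) (2 / 3).
  have /bonus_ge_third : 1 / 3 < s i by lra.
  have /bonus_ge_third : 1 / 3 < s j by lra.
  by lra.
have x_le : 5 / 6 - tsize s A <= 1 / 6 by lra.
have := bonus_ge_affine (a := s i) x_le; have := bonus_ge_affine (a := s j) x_le.
by move=> /(_ ltac:(lra)) + /(_ ltac:(lra)); lra.
Qed.

(** The size term of each bin is paired with the bonus of the next, giving 1 per pair by
    [nofit_chain]; the last two bins have total size above 1 and give 6/5. *)
Lemma light_chain A B (l : seq {set 'I_n}) :
  pairwise nofit [:: A, B & l] ->
  all (fun C => (C != set0) && (binweight C < 1)) [:: A, B & l] ->
  (size l)%:R + 6 / 5 < 6 / 5 * tsize s A + \sum_(C <- B :: l) binweight C.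
Proof.
elim: l A B => [|C l IH] A B /=.
  rewrite !andbT => AB /andP[_ /andP[B0 _]].
  rewrite big_seq1 binweightE; have := nofit_size B0 AB.
  by have := binbonus_ge0 B; lra.
move=> /and3P[/and3P[AB _ _] /andP[BC Bl] Cl] /and4P[/andP[_ WA] /andP[B0 WB] CC all_l].
have /andP[C0 WC] := CC.
have chain := nofit_chain AB BC B0 C0 WA WB WC.
have := IH B C; rewrite /= B0 WB C0 WC all_l BC Bl Cl => /(_ isT isT).
rewrite [in X in _ -> X]big_cons [binweight B]binweightE -natr1.
by move: chain; set T := \sum_(_ <- _) _; lra.
Qed.

(** While more than two bins are left, one of weight at least 1 can be removed; if there is none,
    [light_chain] applies. *)
Lemma first_fit_weight (l : seq {set 'I_n}) : (1 < size l)%N ->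
  pairwise nofit l -> all (fun C => C != set0) l ->
  (size l)%:R - 4 / 5 < \sum_(C <- l) binweight C.
Proof.
have [m] := ubnP (size l); elim: m l => // m IH l lm l2 l_pw l0.
have [/eqP l_eq2|l_neq2] := boolP (size l == 2).
  case: l l_eq2 l_pw l0 {lm l2} => [|A [|B []]] //= _; rewrite !andbT.
  move=> AB /andP[_ B0]; rewrite !big_cons big_nil addr0 !binweightE.
  have := nofit_size B0 AB.
  by have := binbonus_ge0 A; have := binbonus_ge0 B; lra.
have [/hasP[A Al WA]|] := boolP (has (fun C => 1 <= binweight C) l).
  rewrite (big_rem A) //=.
  have sl : size l = (size (rem A l)).+1 by rewrite size_rem // prednK // ltnW.
  have rem_m : (size (rem A l) < m)%N by rewrite -ltnS -sl.
  have rem_2 : (1 < size (rem A l))%N.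
    by rewrite -ltnS -sl ltn_neqAle eq_sym l_neq2.
  have := IH _ rem_m rem_2 (subseq_pairwise (rem_subseq _ _) l_pw).
  rewrite sl -natr1.
  have -> : all (fun C => C != set0) (rem A l).
    by apply/allP => C /mem_rem; exact: (allP l0).
  by move=> /(_ isT); lra.
rewrite -all_predC => Wl.
have {l0 Wl} : all (fun C => (C != set0) && (binweight C < 1)) l.
  apply/allP => C Cl; rewrite (allP l0) //=.
  by have := allP Wl _ Cl; rewrite /= -ltNge.
case: l l2 l_pw {lm l_neq2 IH} => [|A [|B l]] // _ AB l_all.
have -> : (size [:: A, B & l])%:R = (size l)%:R + 2 :> R by rewrite -natrD addn2.
rewrite big_cons [binweight A]binweightE.
have := light_chain AB l_all; have := binbonus_ge0 A.
by set T := \sum_(_ <- _) _; lra.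
Qed.

(** * Greedy repacking guided by given bins *)

Section Refine.
Variables (F : {set 'I_n}) (B : nat -> {set 'I_n}).
Hypothesis B_size : forall k, tsize s (B k) <= 1.

(* [fill D E] extends [D] to a maximal feasible subset of [E]. The bins [ffbin k]
   thus form a First-Fit packing of [F] in which the items of [F :&: B k] are
   packed no later than in bin [k]. *)
Definition fill D E :=
  arg_max D (fun S => [&& D \subset S, S \subset E & tsize s S <= 1])
    (fun S => #|S|).

Fixpoint rest k : {set 'I_n} :=
  if k is k'.+1 then rest k' :\: fill (rest k' :&: B k') (rest k') else F.

Definition ffbin k := fill (rest k :&: B k) (rest k).

Lemma ffbinP k : [/\ rest k :&: B k \subset ffbin k, ffbin k \subset rest k,
  tsize s (ffbin k) <= 1 &
  forall i, i \in rest k.+1 -> 1 < tsize s (ffbin k) + s i].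
Proof.
have D_size : tsize s (rest k :&: B k) <= 1.
  by apply: le_trans (B_size k); apply: tweight_le => //; apply: subsetIr.
rewrite /= -/(ffbin k) /ffbin /fill.
case: arg_maxnP => [|S /and3P[DS SE S1] S_max].
  by rewrite subxx subsetIl D_size.
split=> // i /setDP[iE iS]; rewrite ltNge; apply/negP => Si.
have /S_max : [&& rest k :&: B k \subset i |: S, i |: S \subset rest k
                & tsize s (i |: S) <= 1].
  rewrite (subset_trans DS (subsetUr _ _)) subUset sub1set iE SE /=.
  by rewrite /tsize big_setU1 //= addrC.
by rewrite cardsU1 iS /=; lia.
Qed.

Lemma tweight_rest (u : 'I_n -> R) k :
  tweight u F = \sum_(j < k) tweight u (ffbin j) + tweight u (rest k).
Proof.
elim: k => [|k IH]; first by rewrite big_ord0 add0r.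
rewrite IH big_ord_recr /= -/(ffbin k) -addrA; congr (_ + _).
by apply: tweightD; case: (ffbinP k).
Qed.

Lemma rest_subset (j k : nat) : (j <= k)%N -> rest k \subset rest j.
Proof.
elim: k => [|k IH]; first by rewrite leqn0 => /eqP ->.
rewrite leq_eqVlt => /predU1P[-> //|/IH].
by apply: subset_trans; rewrite /= subsetDl.
Qed.

(** If an item were left, bins 0 to [k] would all be nonempty, so [k + 1 - 4/5 < 17/10 * p], that is
    [10 * (k + 1) < 17 * p + 8]. *)
Lemma rest_empty k (p : nat) : (17 * p + 7 < 10 * k.+1)%N ->
  binweight F <= 17 / 10 * p%:R -> (p = 0 -> F = set0)%N -> rest k = set0.
Proof.
move=> kp WF F0; apply/eqP/negPn/negP => rest_n0.
have bin_n0 (j : nat) : (j < k.+1)%N -> ffbin j != set0.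
  move=> jk; apply/negP => /eqP bin0.
  have [_ _ _ max_j] := ffbinP j.
  have /set0Pn[i ik] : rest j != set0.
    apply: contraNneq rest_n0 => rj; rewrite -subset0 -rj.
    exact: (@rest_subset j k jk).
  have := max_j i; rewrite /= -/(ffbin j) bin0 setD0 => /(_ ik).
  by rewrite /tsize big_set0 add0r; case/andP: (s_bounds i); lra.
(* A positive [p] forces [k.+1 >= 3], so that [first_fit_weight] applies. *)
have [p0|p_gt0] := posnP p.
  by have := rest_subset (leq0n k); rewrite /= F0 // subset0 (negPf rest_n0).
have := @first_fit_weight (mkseq ffbin k.+1).
rewrite size_mkseq => /(_ ltac:(lia)).
have -> : pairwise nofit (mkseq ffbin k.+1).
  apply/(pairwiseP set0) => i j; rewrite !inE size_mkseq => ik jk ij.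
  rewrite !nth_mkseq //; apply/forall_inP => a aj.
  have [_ _ _ max_i] := ffbinP i; apply: max_i.
  have [_ /subsetP sub_j _ _] := ffbinP j.
  exact: (subsetP (rest_subset ij)) (sub_j _ aj).
have -> : all (fun C => C != set0) (mkseq ffbin k.+1).
  by apply/allP => C /mapP[j]; rewrite mem_iota => /andP[_ jk] ->; apply: bin_n0.
move=> /(_ isT isT).
have -> : \sum_(C <- mkseq ffbin k.+1) binweight C
          = \sum_(j < k.+1) binweight (ffbin j).
  by rewrite big_map -[iota _ _]/(index_iota 0 k.+1) big_mkord.
have W_ge0 : 0 <= binweight (rest k.+1).
  apply: tweight_ge0 => i; rewrite /ffweight; have := bonus_ge0 (s i).
  by have := s_ge0 i; lra.
have := tweight_rest (fun i => ffweight (s i)) k.+1.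
rewrite -/(binweight F) -/(binweight (rest _)) => WFE.
have : (17 * p + 8)%:R <= (10 * k.+1)%:R :> R by rewrite ler_nat; lia.
rewrite natrD !natrM; move: WFE; rewrite /binweight; move: W_ge0 WF.
rewrite /binweight; set X := \sum_(_ < _) _; lra.
Qed.

End Refine.
End FirstFit.

(** * Cost as a sum of remaining weights *)

Section Costs.
Variables (R : realFieldType) (n : nat) (w : 'I_n -> R).
Implicit Types (Bs : seq {set 'I_n}) (k : nat).

Lemma remaining0 Bs : remaining Bs 0 = [set: 'I_n].
Proof. by rewrite /remaining big_ord0 setC0. Qed.

Lemma remainingS Bs k : remaining Bs k.+1 = remaining Bs k :\: nth set0 Bs k.
Proof. by rewrite /remaining big_ord_recr /= setCU setDE. Qed.

Lemma remaining_ge Bs k : remaining Bs (size Bs) = set0 -> (size Bs <= k)%N ->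
  remaining Bs k = set0.
Proof.
move=> Bs_end; elim: k => [|k IH]; first by rewrite leqn0 => /eqP <-.
rewrite leq_eqVlt => /predU1P[<- //|/IH]; rewrite remainingS => ->.
exact: set0D.
Qed.

(** Common form of KB outputs and feasible solutions. The index is unbounded because [nth] returns
    [set0] past the end. *)
Definition packing Bs :=
  (forall k, nth set0 Bs k \subset remaining Bs k) /\
  remaining Bs (size Bs) = set0.

Lemma tweight_remaining (u : 'I_n -> R) Bs k : packing Bs ->
  tweight u (remaining Bs k)
  = tweight u (nth set0 Bs k) + tweight u (remaining Bs k.+1).
Proof. by move=> [Bs_sub _]; rewrite remainingS; exact: tweightD. Qed.

(** Summation by parts. The free horizon [m] lets two costs be cut at multiples of 17 and 10. *)
Lemma cost_remaining Bs m : packing Bs -> (size Bs <= m)%N ->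
  cost w Bs = \sum_(k < m) tweight w (remaining Bs k).
Proof.
move=> BsP size_m; have [_ Bs_end] := BsP.
have abel q : \sum_(k < q) (k.+1)%:R * tweight w (nth set0 Bs k)
    = \sum_(k < q) tweight w (remaining Bs k) - q%:R * tweight w (remaining Bs q).
  elim: q => [|q IH]; first by rewrite !big_ord0 mul0r subr0.
  by rewrite !big_ord_recr /= IH (tweight_remaining w q BsP) -!natr1; ring.
rewrite /cost abel Bs_end tweight_set0 mulr0 subr0.
rewrite -(subnKC size_m) big_split_ord /= [X in _ + X]big1 ?addr0 // => k _.
by rewrite remaining_ge ?tweight_set0 ?leq_addr.
Qed.

End Costs.

(** * Sampling inequality for convex sequences *)

(* Up to an additive constant, [r] on [0, 17] is a nonnegative combination of
   the hinges [k |-> max (m - k) 0] with [m <= 17]; the inequality holds for each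
   of them, and holds with equality for constants since 10 * 17 = 17 * 10. *)
Lemma convex_block_sum (R : realFieldType) (r : nat -> R) :
  (forall k, r k.+1 <= r k) ->
  (forall k, r k.+1 - r k.+2 <= r k - r k.+1) ->
  10 * \sum_(k < 17) r k <= 17 * \sum_(p < 10) r ((17 * p + 7) %/ 10)%N.
Proof.
(* Convexity carries [r 17 <= r 16] back to all earlier steps. *)
move=> /(_ 16) r16 r_convex.
rewrite !big_ord_recr !big_ord0 /= !add0r.
rewrite -[((_ * 1 + _) %/ _)%N]/2%N -[((_ * 2 + _) %/ _)%N]/4%N.
rewrite -[((_ * 3 + _) %/ _)%N]/5%N -[((_ * 4 + _) %/ _)%N]/7%N.
rewrite -[((_ * 5 + _) %/ _)%N]/9%N -[((_ * 6 + _) %/ _)%N]/10%N.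
rewrite -[((_ * 7 + _) %/ _)%N]/12%N -[((_ * 8 + _) %/ _)%N]/14%N.
rewrite -[((_ * 9 + _) %/ _)%N]/16%N.
have := r_convex 0; have := r_convex 1; have := r_convex 2; have := r_convex 3.
have := r_convex 4; have := r_convex 5; have := r_convex 6; have := r_convex 7.
have := r_convex 8; have := r_convex 9; have := r_convex 10; have := r_convex 11.
have := r_convex 12; have := r_convex 13; have := r_convex 14; have := r_convex 15.
lra.
Qed.

(** Raising [p] by 10 raises the sampled index by exactly 17, so the blocks are translates of the
    first. *)
Lemma convex_sum (R : realFieldType) (r : nat -> R) (b : nat) :
  (forall k, r k.+1 <= r k) ->
  (forall k, r k.+1 - r k.+2 <= r k - r k.+1) ->
  10 * \sum_(k < 17 * b) r k
  <= 17 * \sum_(p < 10 * b) r ((17 * p + 7) %/ 10)%N.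
Proof.
move=> r_decr r_convex; elim: b => [|b IH]; first by rewrite !muln0 !big_ord0 !mulr0.
rewrite (mulnSr 17) (mulnSr 10) (@big_split_ord _ _ _ (17 * b)) (@big_split_ord _ _ _ (10 * b)) /=.
rewrite !mulrDr lerD //.
have -> : \sum_(p < 10) r ((17 * (10 * b + p) + 7) %/ 10)%N
        = \sum_(p < 10) r (17 * b + (17 * p + 7) %/ 10)%N.
  by apply: eq_bigr => p _; congr r; lia.
by apply: (@convex_block_sum _ (fun k => r (17 * b + k)%N)) => k; rewrite !addnS.
Qed.

(** * Comparison of KB with a feasible solution *)

Section Comparison.
Variables (R : realFieldType) (n : nat) (s w : 'I_n -> R).
Hypothesis s_bounds : forall i, 0 < s i <= 1.

Lemma feasible_packing (Opt : seq {set 'I_n}) :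
  feasible_solution s Opt -> packing Opt.
Proof.
move=> [Opt_cover [Opt_disj _]]; split=> [k|].
  have [k_lt|k_ge] := ltnP k (size Opt); last by rewrite nth_default ?sub0set.
  rewrite /remaining -disjoints_subset.
  apply/bigcup_disjointP => j _; have j_lt := ltn_trans (ltn_ord j) k_lt.
  by apply: Opt_disj => // kj; have := ltn_ord j; rewrite -kj ltnn.
apply/eqP; rewrite -subset0; apply/subsetP => i; rewrite !inE => /negP[]; apply/bigcupP.
have [B B_in iB] := Opt_cover i; have := B_in; rewrite -index_mem => B_lt.
by exists (Ordinal B_lt); rewrite //= nth_index.
Qed.

Lemma feasible_size (Opt : seq {set 'I_n}) k :
  feasible_solution s Opt -> tsize s (nth set0 Opt k) <= 1.
Proof.
move=> [_ [_ Opt_size]]; have [/Opt_size //|k_ge] := ltnP k (size Opt).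
by rewrite nth_default // /tsize big_set0 ler01.
Qed.

Lemma KB_packing (Bs : seq {set 'I_n}) : KB_output s w Bs -> packing Bs.
Proof.
move=> [Bs_step Bs_end]; split=> // k.
have [/Bs_step[] //|k_ge] := ltnP k (size Bs).
by rewrite nth_default ?sub0set.
Qed.

Lemma KB_size (Bs : seq {set 'I_n}) k :
  KB_output s w Bs -> tsize s (nth set0 Bs k) <= 1.
Proof.
move=> [Bs_step _]; have [/Bs_step[] //|k_ge] := ltnP k (size Bs).
by rewrite nth_default // /tsize big_set0 ler01.
Qed.

Lemma KB_max (Bs : seq {set 'I_n}) k (S : {set 'I_n}) : KB_output s w Bs ->
  S \subset remaining Bs k -> tsize s S <= 1 ->
  tweight w S <= tweight w (nth set0 Bs k).
Proof.
move=> BsP; have [Bs_step Bs_end] := BsP.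
have [/Bs_step[_ _ _ max_k]|k_ge] := ltnP k (size Bs); first exact: max_k.
by rewrite remaining_ge // subset0 nth_default // => /eqP ->.
Qed.

Lemma binweight_packed (Opt : seq {set 'I_n}) p : feasible_solution s Opt ->
  binweight s (~: remaining Opt p) <= 17 / 10 * p%:R.
Proof.
move=> OptF; elim: p => [|p IH].
  by rewrite remaining0 setCT /binweight tweight_set0 mulr0.
have sub_p : nth set0 Opt p \subset remaining Opt p.
  by case: (feasible_packing OptF).
rewrite remainingS setCD /binweight.
rewrite (@tweightD _ _ _ _ (~: remaining Opt p)) ?subsetUl //.
rewrite setDUl setDv set0U setDE setCK (setIidPl sub_p).
have := binweight_le s_bounds (feasible_size p OptF).
by move: IH; rewrite /binweight -natr1; lra.
Qed.

Lemma remaining_KB_le (Bs Opt : seq {set 'I_n}) p :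
  KB_output s w Bs -> feasible_solution s Opt ->
  tweight w (remaining Bs ((17 * p + 7) %/ 10)) <= tweight w (remaining Opt p).
Proof.
move=> BsP OptF; set m := (_ %/ _)%N; set F := ~: remaining Opt p.
have Bs_size k := KB_size k BsP.
have rest_m : rest s F (nth set0 Bs) m = set0.
  apply: (@rest_empty _ _ _ s_bounds F _ Bs_size m p); first by rewrite /m; lia.
    exact: binweight_packed.
  by move=> p0; rewrite /F p0 remaining0 setCT.
(* Each new bin absorbs what is left of its KB bin, so later new bins are candidates for later KB
   choices. *)
have rest_rem k : rest s F (nth set0 Bs) k \subset remaining Bs k.
  elim: k => [|k IH]; first by rewrite remaining0 subsetT.
  have [in_bin _ _ _] := ffbinP s_bounds F Bs_size k.
  apply/subsetP => i; rewrite remainingS /= -/(ffbin _ _ _ _) => /setDP[i_rest i_bin].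
  rewrite inE (subsetP IH) // andbT; apply: contra i_bin => iB.
  by apply: (subsetP in_bin); rewrite inE i_rest.
have F_le : tweight w F <= \sum_(k < m) tweight w (nth set0 Bs k).
  rewrite (tweight_rest s_bounds F Bs_size w m) rest_m tweight_set0 addr0.
  apply: ler_sum => k _; have [_ sub_k size_k _] := ffbinP s_bounds F Bs_size k.
  exact: KB_max (subset_trans sub_k (rest_rem k)) size_k.
have total : tweight w setT
    = \sum_(k < m) tweight w (nth set0 Bs k) + tweight w (remaining Bs m).
  elim: (m) => [|k IH]; first by rewrite big_ord0 add0r remaining0.
  by rewrite IH big_ord_recr /= -addrA -tweight_remaining //; exact: KB_packing BsP.
have := tweightD w (subsetT F); rewrite setTD setCK total.
by move: F_le; set T := \sum_(_ < _) _; lra.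
Qed.

End Comparison.

Unset Implicit Arguments.

Theorem theorem1 (R : realFieldType) (n : nat) (s w : 'I_n -> R)
    (Bs : seq {set 'I_n}) :
  mwsbp_instance s w -> KB_output s w Bs ->
  forall Opt : seq {set 'I_n}, feasible_solution s Opt ->
    cost w Bs <= (17%:R / 10%:R) * cost w Opt.
Proof.
move=> inst BsP Opt OptF.
have s_bounds i : 0 < s i <= 1 by case: (inst i).
have w_ge0 i : 0 <= w i by case: (inst i) => _ /ltW.
have BsPack := KB_packing BsP; pose r k := tweight w (remaining Bs k).
have rS k : r k - r k.+1 = tweight w (nth set0 Bs k).
  by rewrite /r (tweight_remaining w k BsPack) addrK.
pose b := (size Bs + size Opt)%N.
rewrite (cost_remaining (m := 17 * b) w BsPack); last by rewrite /b; lia.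
rewrite (cost_remaining (m := 10 * b) w (feasible_packing OptF)); last by rewrite /b; lia.
have r_decr k : r k.+1 <= r k by rewrite -subr_ge0 rS tweight_ge0.
(* The next KB bin was already available when bin [k] was chosen. *)
have r_convex k : r k.+1 - r k.+2 <= r k - r k.+1.
  rewrite !rS; apply: (KB_max BsP); last exact: KB_size BsP.
  case: BsPack => sub_r _; apply: subset_trans (sub_r _) _.
  by rewrite remainingS subsetDl.
have := convex_sum b r_decr r_convex.
have : \sum_(p < 10 * b) r ((17 * p + 7) %/ 10)%N
       <= \sum_(p < 10 * b) tweight w (remaining Opt p).
  by apply: ler_sum => p _; exact: remaining_KB_le.
rewrite /r; set X := \sum_(_ < _) _; set Y := \sum_(_ < _) _.
by set Z := \sum_(_ < _) _; lra.
Qed.
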